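(* There is a deterministic algorithm for graph reconstruction using a shortest path oracle whose query complexity is $$n^{1+O\left(\sqrt{(\log\log n+\log\Delta)/\log n}\right)},$$ where $\Delta$ is the maximum degree of $G$. Moreover, if $G$ has treewidth $\mathrm{tw}$, its query complexity is $O(\Delta(\Delta+\mathrm{tw}\log n)\,n\log^2 n)$.
   Context: Let $G=(V,E)$ be an unknown connected, unweighted, undirected simple graph with $|V|=n$. A shortest path oracle receives a pair $(u,v)\in V^2$ and returns some shortest path in $G$ between $u$ and $v$. In the reconstruction problem, an algorithm is given $V$, has access to the oracle, and must output $E$. The query complexity is the maximum number of oracle queries made. *)

(* Defs.v *)
From mathcomp Require Import all_boot.
From Stdlib Require Import Reals.
Set Implicit Arguments. Unset Strict Implicit. Unset Printing Implicit Defensive.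

Definition simple_graph (n : nat) (e : rel 'I_n) : Prop :=
  (forall x, e x x = false) /\ (forall x y, e x y = e y x).

Definition connected_graph (n : nat) (e : rel 'I_n) : Prop :=
  forall u v, connect e u v.

Definition max_degree (n : nat) (e : rel 'I_n) : nat :=
  \max_(v : 'I_n) #|[set w | e v w]|.

Definition is_path_between (n : nat) (e : rel 'I_n) (u v : 'I_n) (p : seq 'I_n) : bool :=
  if p is x :: q then [&& x == u, path e x q & last x q == v] else false.

Definition is_shortest_path (n : nat) (e : rel 'I_n) (u v : 'I_n) (p : seq 'I_n) : Prop :=
  is_path_between e u v p /\
  forall q, is_path_between e u v q -> size p <= size q.

(* Deterministic adaptive algorithm on vertex set 'I_n: a decision tree
   that either outputs an edge relation, or queries the oracle on (u,v)
   and continues depending on the returned path. *)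
Inductive qtree (n : nat) : Type :=
| Done : rel 'I_n -> qtree n
| Query : 'I_n -> 'I_n -> (seq 'I_n -> qtree n) -> qtree n.

(* [reconstructs e t k]: against every (adaptive) shortest path oracle for
   the graph e, the algorithm t makes at most k queries and outputs exactly E. *)
Fixpoint reconstructs (n : nat) (e : rel 'I_n) (t : qtree n) (k : nat) : Prop :=
  match t with
  | Done E => forall x y, E x y = e x y
  | Query u v f =>
      match k with
      | 0 => False
      | k'.+1 => forall p, is_shortest_path e u v p -> reconstructs e (f p) k'
      end
  end.

Definition is_tree (m : nat) (t : rel 'I_m) : Prop :=
  0 < m /\ simple_graph t /\ connected_graph t /\
  #|[set p : 'I_m * 'I_m | t p.1 p.2]| = (m.-1).*2.

Definition tree_decomposition (n m : nat) (e : rel 'I_n) (t : rel 'I_m)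
  (B : 'I_m -> {set 'I_n}) : Prop :=
  is_tree t /\
  (forall x : 'I_n, exists i, x \in B i) /\
  (forall x y : 'I_n, e x y -> exists i, (x \in B i) && (y \in B i)) /\
  (forall (x : 'I_n) (i j : 'I_m), x \in B i -> x \in B j ->
     connect [rel a b | [&& t a b, x \in B a & x \in B b]] i j).

Definition decomposition_width (n m : nat) (B : 'I_m -> {set 'I_n}) : nat :=
  (\max_(i : 'I_m) #|B i|).-1.

Definition has_decomposition_of_width (n : nat) (e : rel 'I_n) (k : nat) : Prop :=
  exists m (t : rel 'I_m) (B : 'I_m -> {set 'I_n}),
    tree_decomposition e t B /\ decomposition_width B = k.

Definition treewidth (n : nat) (e : rel 'I_n) (tw : nat) : Prop :=
  has_decomposition_of_width e tw /\
  forall k, has_decomposition_of_width e k -> tw <= k.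

(* Main.v *)
Require Import Defs.
From Stdlib Require Import Reals Lra ZArith.
From mathcomp Require Import all_boot.
From mathcomp Require Import zify.
(* Loading zify rebinds the key [R] to MathComp's [ring_scope]. *)
Delimit Scope R_scope with R.
Set Implicit Arguments. Unset Strict Implicit. Unset Printing Implicit Defensive.

(** The algorithm is greedy. It keeps the graph [H] of the edges seen so far and
a set of pairs known not to be edges. While [H] is disconnected it queries a
disconnected pair; otherwise it queries the pair which, if the distance in [H]
were the true one, would rule out the most unsettled pairs. An answer that
leaves [H] reveals a new edge, and this happens at most [n * Delta] times; an
answer inside [H] confirms the distance and rules out the pairs. If [t] queries
suffice to rule out all non-edges of every connected subgraph of the graph, each
answer of the second kind divides the number of unsettled pairs by at least
[t / (t - 1)], so that [O(t log n)] of them occur.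

Query sets for a fixed connected graph are found as follows. If [s] lies on a
shortest path between non-adjacent [a] and [b], then querying [a] and [b] against
[s] and its neighbours rules out [ab]. With a tree decomposition of width [tw], a
recursive centroid decomposition gives each vertex [O(tw log n)] hubs such that
every path from [a] to [b] contains a common hub of [a] and [b]. In general,
for a vertex set [W] with at most [t ^ (k + 1)] elements, there are [O(t log n)]
centers (as in the Thorup-Zwick distance oracles) such that every cluster, made
of the vertices of [W] closer to a given vertex than to any center, has at most
[t ^ k] elements. Querying the vertices within distance 2 of a center against
[W] leaves only pairs inside the clusters of these vertices, where the
construction is repeated; finally [k] is of order [sqrt (log n / log (Delta log n))]
and [t] about [n ^ (1 / k)]. *)

(** * Distances *)

(* Equal to [#|T|] when [v] is not reachable from [u]. *)
Definition gdist (T : finType) (e : rel T) (u v : T) : nat :=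
  find (fun k => [exists p : k.-tuple T, path e u p && (last u p == v)])
       (iota 0 #|T|).

Lemma gdist_max (T : finType) (e : rel T) u v : gdist e u v <= #|T|.
Proof. by rewrite /gdist -[leqRHS](size_iota 0) find_size. Qed.

Lemma gdist_le_path (T : finType) (e : rel T) u p :
  path e u p -> gdist e u (last u p) <= size p.
Proof.
move=> ep; case: (ltnP (size p) #|T|) => [lt|]; last exact: leq_trans (gdist_max _ _ _).
rewrite leqNgt; apply/negP => /(before_find 0); rewrite nth_iota // add0n => /negbT /negP; apply.
by apply/existsP; exists (in_tuple p); rewrite ep eqxx.
Qed.

Lemma gdist_ltP (T : finType) (e : rel T) u v : gdist e u v < #|T| ->
  exists p, [/\ path e u p, last u p = v & size p = gdist e u v].
Proof.
move=> lt.
have hs : has (fun k => [exists p : k.-tuple T, path e u p && (last u p == v)]) (iota 0 #|T|).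
  by rewrite has_find size_iota.
have := nth_find 0 hs; rewrite -/(gdist e u v) nth_iota // add0n => /existsP[p /andP[ep /eqP lp]].
by exists p; rewrite size_tuple.
Qed.

Lemma connect_gdist_lt (T : finType) (e : rel T) u v :
  connect e u v = (gdist e u v < #|T|).
Proof.
apply/idP/idP => [/connectP[p ep ->] | /gdist_ltP[p [ep lp _]]]; last first.
  by apply/connectP; exists p.
have [q eq uq _] := shortenP ep.
apply: leq_ltn_trans (gdist_le_path eq) _.
by have := max_card [in u :: q]; rewrite (card_uniqP uq).
Qed.

Lemma gdistP (T : finType) (e : rel T) u v : connect e u v ->
  exists p, [/\ path e u p, last u p = v & size p = gdist e u v].
Proof. by rewrite connect_gdist_lt => /gdist_ltP. Qed.

Lemma gdistxx (T : finType) (e : rel T) u : gdist e u u = 0.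
Proof. by apply/eqP; rewrite -leqn0 (@gdist_le_path T e u [::]). Qed.

Lemma gdist_eq0 (T : finType) (e : rel T) u v : gdist e u v = 0 -> u = v.
Proof.
move=> d0; have : gdist e u v < #|T| by rewrite d0; apply/card_gt0P; exists u.
by case/gdist_ltP=> -[|x p] [_ lp]; rewrite d0.
Qed.

Lemma gdist_le1 (T : finType) (e : rel T) u v :
  connect e u v -> gdist e u v <= 1 -> (u == v) || e u v.
Proof.
move=> /gdistP[p []]; case: p => [|x [|y p]] /=.
- by move=> _ -> _ _; rewrite eqxx.
- by rewrite andbT => exy <- _ _; rewrite exy orbT.
- by move=> _ _ <-.
Qed.

Lemma gdist_edge (T : finType) (e : rel T) u v : e u v -> gdist e u v <= 1.
Proof. by move=> euv; apply: (@gdist_le_path T e u [:: v]); rewrite /= euv. Qed.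

Lemma gdist_triangle (T : finType) (e : rel T) u v w :
  gdist e u w <= gdist e u v + gdist e v w.
Proof.
(* If [v] is not reachable from [u], the first summand is already the maximal value [#|T|]. *)
have [lt1|/(leq_trans (gdist_max e u w)) h] := ltnP (gdist e u v) #|T|; last first.
  exact: leq_trans h (leq_addr _ _).
have [lt2|/(leq_trans (gdist_max e u w)) h] := ltnP (gdist e v w) #|T|; last first.
  exact: leq_trans h (leq_addl _ _).
have [p [ep lp <-]] := gdist_ltP lt1; have [q [eq lq <-]] := gdist_ltP lt2.
rewrite -size_cat -lq -lp -last_cat; apply: gdist_le_path.
by rewrite cat_path ep lp.
Qed.

Lemma gdist_sym (T : finType) (e : rel T) : symmetric e ->
  forall u v, gdist e u v = gdist e v u.
Proof.
move=> es; suff H u v : gdist e v u <= gdist e u v.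
  by move=> u v; apply/eqP; rewrite eqn_leq !H.
have [lt|/(leq_trans (gdist_max e v u))//] := ltnP (gdist e u v) #|T|.
have [p [ep lp <-]] := gdist_ltP lt.
have := rev_path e u p; rewrite lp => rp.
have -> : u = last v (rev (belast u p)).
  by case: p {ep rp} lp => [|x p] //= _; rewrite rev_cons last_rcons.
rewrite -(size_belast u p) -size_rev; apply: gdist_le_path; rewrite rp.
by rewrite (eq_path (e' := e)) // => x y /=; rewrite es.
Qed.

Lemma gdist_path_split (T : finType) (e : rel T) u v i :
  connect e u v -> i <= gdist e u v ->
  exists w, gdist e u w = i /\ gdist e w v = gdist e u v - i.
Proof.
move=> /gdistP[p [ep lp sp]] le.
have := ep; rewrite -{1}(cat_take_drop i p) cat_path => /andP[e1 e2].
have l2 : last (last u (take i p)) (drop i p) = v by rewrite -last_cat cat_take_drop.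
have h1 := gdist_le_path e1; have h2 := gdist_le_path e2.
rewrite l2 size_drop sp in h2; rewrite size_take sp in h1.
have h3 := gdist_triangle e u (last u (take i p)) v.
exists (last u (take i p)).
case: ltnP h1 => ?; lia.
Qed.

Lemma gdist_mem_path (T : finType) (e : rel T) u v p s :
  path e u p -> last u p = v -> size p = gdist e u v -> s \in u :: p ->
  gdist e u s + gdist e s v = gdist e u v.
Proof.
move=> ep lp sp sp'; case/splitPl: sp' ep lp sp => p1 p2 l1.
rewrite cat_path last_cat l1 size_cat => /andP[e1 e2] l2 sp.
have := gdist_le_path e1; have := gdist_le_path e2; rewrite l1 l2.
have := gdist_triangle e u s v; lia.
Qed.

Lemma card_bigcup_leq (I T : finType) (A : {set I}) (F : I -> {set T}) k :
  (forall i, i \in A -> #|F i| <= k) -> #|\bigcup_(i in A) F i| <= #|A| * k.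
Proof.
move=> hF; rewrite -sum_nat_const.
elim/big_rec2: _ => [|i B m iA h]; rewrite ?cards0 // cardsU.
by apply: leq_trans (leq_subr _ _) (leq_add (hF _ iA) h).
Qed.

(** The geometric sum [1 + D + ... + D ^ k]. *)
Fixpoint ball_bound (D k : nat) : nat :=
  if k is k'.+1 then 1 + D * ball_bound D k' else 1.

Lemma card_ball (T : finType) (e : rel T) D k s :
  (forall u v, connect e u v) ->
  (forall v, #|[set w | e v w]| <= D) ->
  #|[set x | gdist e s x <= k]| <= ball_bound D k.
Proof.
move=> ec hD; elim: k s => [|k IH] s /=.
  rewrite -(cards1 s); apply/subset_leq_card/subsetP => x; rewrite !inE leqn0.
  by move=> /eqP /gdist_eq0 ->.
apply: leq_trans (_ : #|[set s] :|: \bigcup_(y in [set w | e s w]) [set x | gdist e y x <= k]| <= _).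
  apply/subset_leq_card/subsetP => x; rewrite !inE => h.
  have [-> //|nsx] := eqVneq x s; rewrite orFb.
  have [p [ep lp sp]] := gdistP (ec s x).
  case: p ep lp sp => [|y p] /=; first by move=> _ xs; rewrite xs eqxx in nsx.
  move=> /andP[esy ep] lp sp; apply/bigcupP; exists y; rewrite ?inE //.
  rewrite -lp; apply: leq_trans (gdist_le_path ep) _; lia.
rewrite cardsU cards1; apply: leq_trans (leq_subr _ _) _; rewrite leq_add2l.
apply: leq_trans (card_bigcup_leq (fun y _ => IH y)) _.
by rewrite leq_mul2r hD orbT.
Qed.

(** * The greedy algorithm *)

(* If the distance between [q.1] and [q.2] is the same in a supergraph of [e]
   as in [e], then the supergraph does not have the edge [ab]: it would be a
   shortcut. *)
Definition rules_out (T : finType) (e : rel T) (q ab : T * T) : bool :=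
  (gdist e q.1 ab.1 + 1 + gdist e ab.2 q.2 < gdist e q.1 q.2) ||
  (gdist e q.1 ab.2 + 1 + gdist e ab.1 q.2 < gdist e q.1 q.2).

Definition certifies (T : finType) (e : rel T) (Q : {set T * T}) (a b : T) : Prop :=
  exists q, q \in Q /\ rules_out e q (a, b).

Definition rel_of (T : finType) (X : {set T * T}) : rel T :=
  [rel a b | (a, b) \in X].

(** Both orientations are included so that the known edges form a symmetric relation. *)
Definition path_edges (T : finType) (p : seq T) : {set T * T} :=
  [set ab | (ab \in zip p (behead p)) || ((ab.2, ab.1) \in zip p (behead p))].

Definition next_query (T : finType) (X U : {set T * T}) (q0 : T * T) : T * T :=
  if [pick q | ~~ connect (rel_of X) q.1 q.2] is Some q then q
  else [arg max_(q > q0) #|[set ab in U | rules_out (rel_of X) q ab]|].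

(* [X] is the set of known edges and [Y] a set of pairs known not to be edges. *)
Fixpoint greedy (n fuel : nat) (X Y : {set 'I_n * 'I_n}) : qtree n :=
  if fuel is f.+1 then
    let U := ~: (X :|: Y) in
    if [pick q in U] is Some q0 then
      let q := next_query X U q0 in
      Query q.1 q.2 (fun p => greedy f (X :|: path_edges p)
        (if sorted (rel_of X) p then Y :|: [set ab | rules_out (rel_of X) q ab] else Y))
    else Done (rel_of X)
  else Done (rel_of X).

Lemma path_zip (T : eqType) (e : rel T) x p :
  path e x p = all (fun ab => e ab.1 ab.2) (zip (x :: p) p).
Proof. by elim: p x => //= y p IH x; rewrite IH. Qed.

(** Distances in [e] are at most those in [h], so an edge [ab] of [e] would give a walk from [u] to
    [v] shorter than [gdist h u v]. *)
Lemma rules_out_sound (T : finType) (h e : rel T) u v a b : symmetric e ->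
  subrel h e -> (forall x y, connect h x y) -> gdist h u v <= gdist e u v ->
  rules_out h (u, v) (a, b) -> ~~ e a b.
Proof.
move=> es he hc huv hr; apply/negP => eab.
have mono x y : gdist e x y <= gdist h x y.
  have [p [hp <- <-]] := gdistP (hc x y); apply: gdist_le_path.
  exact: sub_path he _ _ hp.
have eba : e b a by rewrite es.
have := gdist_edge eab; have := gdist_edge eba.
have := gdist_triangle e u a v; have := gdist_triangle e a b v.
have := gdist_triangle e u b v; have := gdist_triangle e b a v.
have := mono u a; have := mono b v; have := mono u b; have := mono a v.
case/orP: hr => /=; lia.
Qed.

Lemma shortest_path_gdist n (e : rel 'I_n) u v p : is_shortest_path e u v p ->
  exists s, [/\ p = u :: s, path e u s, last u s = v & size s <= gdist e u v].
Proof.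
case; case: p => [//|x s] /= /and3P[/eqP -> es /eqP ls] hmin; exists s; split=> //.
have [] := @gdistP _ e u v; first by apply/connectP; exists s.
move=> q [eq lq <-]; have /= := hmin (u :: q); apply.
by rewrite eqxx eq lq eqxx.
Qed.

(** Pigeonhole: the at most [k] queries of [Q] together cover [U], and the greedy choice does at
    least as well as the best of them. *)
Lemma next_query_large (T : finType) (X U Q : {set T * T}) q0 k :
  (forall x y, connect (rel_of X) x y) -> #|Q| <= k ->
  (forall ab, ab \in U -> certifies (rel_of X) Q ab.1 ab.2) ->
  #|U| <= k * #|[set ab in U | rules_out (rel_of X) (next_query X U q0) ab]|.
Proof.
move=> hc hQ hcert; rewrite /next_query.
case: pickP => [q|_]; first by rewrite hc.
case: arg_maxnP => // q _ hmax.
apply: leq_trans (_ : #|\bigcup_(q' in Q) [set ab in U | rules_out (rel_of X) q' ab]| <= _).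
  apply/subset_leq_card/subsetP => ab abU; have [q' [q'Q r]] := hcert _ abU.
  by apply/bigcupP; exists q'; rewrite ?inE ?abU //; case: (ab) r.
apply: leq_trans (leq_mul hQ (leqnn _)).
by apply: card_bigcup_leq => q' _; apply: hmax.
Qed.

(** Here [j] bounds the ordered edges still unknown, hence the answers that leave [X]; [r] is the
    budget for answers inside [X], each of which multiplies the number of unsettled pairs by at most
    [t.-1 / t]. The fuel suffices because every query settles a pair. *)
Lemma greedy_reconstructs n (e : rel 'I_n) t : simple_graph e ->
  (forall h : rel 'I_n, simple_graph h -> connected_graph h -> subrel h e ->
     exists Q : {set 'I_n * 'I_n}, #|Q| <= t /\
       forall a b, a != b -> ~~ h a b -> certifies h Q a b) ->
  forall f (X Y : {set 'I_n * 'I_n}) j r,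
    (forall a b, ((a, b) \in X) = ((b, a) \in X)) ->
    subrel (rel_of X) e ->
    (forall a, (a, a) \in Y) -> (forall a b, (a, b) \in Y -> ~~ e a b) ->
    #|[set ab | e ab.1 ab.2] :\: X| <= j ->
    #|~: (X :|: Y)| <= f ->
    #|~: (X :|: Y)| * t.-1 ^ r < t ^ r ->
    reconstructs e (greedy f X Y) (j + r).
Proof.
move=> [e0 es] hQ; elim=> [|f IH] X Y j r Xs Xe Yd Ye.
  move=> _ hU _ x y; move: hU; rewrite leqn0 cards_eq0 => /eqP/setP/(_ (x, y)).
  rewrite !inE => /negbFE h; apply/idP/idP => [/Xe //|exy].
  by case/orP: h => // /Ye; rewrite exy.
move=> hj hU hr; rewrite [greedy _ _ _]/=.
set U := ~: (X :|: Y) in hU hr *.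
case: pickP => [q0 q0U | U0]; last first.
  move=> x y; have := U0 (x, y); rewrite !inE => /negbFE h.
  apply/idP/idP => [/Xe //|exy].
  by case/orP: h => // /Ye; rewrite exy.
have U_gt0 : 0 < #|U| by apply/card_gt0P; exists q0.
set q := next_query X U q0.
suff H p : is_shortest_path e q.1 q.2 p -> exists2 k, j + r = k.+1 &
    reconstructs e (greedy f (X :|: path_edges p)
        (if sorted (rel_of X) p then Y :|: [set ab | rules_out (rel_of X) q ab] else Y)) k.
  (* With no query left, [r = 0] and the decay hypothesis makes [U] empty, against [q0]. *)
  rewrite /=; case E: (j + r) H => [|k'] H.
    move: hr; have -> : r = 0 by lia.
    by rewrite !expn0; lia.
  by move=> p /H[k [->]].
case/shortest_path_gdist => s [-> ep ls sz].
have Xs' a b : ((a, b) \in X :|: path_edges (q.1 :: s)) = ((b, a) \in X :|: path_edges (q.1 :: s)).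
  by rewrite !inE Xs /= orbC [X in _ = X]orbC [X in X || _ = _]orbC.
have Xe' : subrel (rel_of (X :|: path_edges (q.1 :: s))) e.
  move=> a b; rewrite /rel_of /= !inE => /orP[/Xe //|].
  move: ep; rewrite path_zip => /allP h /orP[/h //|/h /=].
  by rewrite es.
(* An answer with an unknown edge lowers [j]; [r] is kept, as the unsettled pairs only decrease. *)
rewrite [sorted _ _]/=; case: ifP => pX; last first.
  have /allPn[[a b] abs nab] : ~~ all (fun ab => rel_of X ab.1 ab.2) (zip (q.1 :: s) s).
    by rewrite -path_zip pX.
  have eab : e a b by move: ep; rewrite path_zip => /allP /(_ _ abs).
  have abP : (a, b) \in path_edges (q.1 :: s) by rewrite inE abs.
  have abU : (a, b) \in U.
    rewrite !inE negb_or -/(rel_of X a b) nab /=; apply/negP => /Ye; by rewrite eab.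
  have lt1 : #|[set ab | e ab.1 ab.2] :\: (X :|: path_edges (q.1 :: s))| <
             #|[set ab | e ab.1 ab.2] :\: X|.
    apply/proper_card/properP; split; first by apply: setDS; apply: subsetUl.
    exists (a, b); last by rewrite !inE abs /= orbT.
    by rewrite !inE eab andbT.
  have lt2 : #|~: (X :|: path_edges (q.1 :: s) :|: Y)| < #|U|.
    apply/proper_card/properP; split; first by rewrite setCS setSU // subsetUl.
    exists (a, b) => //.
    by rewrite !inE abs /= !orbT.
  have lt1' := leq_trans lt1 hj.
  have j0 : 0 < j by apply: leq_ltn_trans lt1'.
  exists (j.-1 + r); first by rewrite -addSn prednK.
  apply: IH => //.
  - by rewrite -ltnS prednK.
  - by rewrite -ltnS; apply: leq_trans lt2 hU.
  - by apply: leq_ltn_trans hr; rewrite leq_mul2r (ltnW lt2) orbT.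
(* The answer joins the queried pair inside [rel_of X], whereas a disconnected [rel_of X] would have
   led to querying a disconnected pair. *)
have hc : connected_graph (rel_of X).
  move=> x y; apply: contraT => nc.
  have : connect (rel_of X) q.1 q.2 by apply/connectP; exists s; rewrite ?ls.
  rewrite /q /next_query; case: pickP => [q' /negPf -> //|/(_ (x, y))].
  by rewrite nc.
have hs : simple_graph (rel_of X).
  split=> [x|x y]; last exact: Xs.
  by apply/negP => /Xe; rewrite e0.
have [Q [cQ hcert]] := hQ _ hs hc Xe.
have hU2 := @next_query_large _ X U Q q0 t hc cQ.
rewrite -/q in hU2.
set c := [set ab in U | rules_out (rel_of X) q ab] in hU2.
have {}hU2 : #|U| <= t * #|c|.
  apply: hU2 => -[a b]; rewrite !inE negb_or => /andP[abX abY].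
  apply: hcert => //; apply: contraNneq abY => /= ->; exact: Yd.
set D := [set ab | rules_out (rel_of X) q ab].
have cE : c = U :&: D by apply/setP => ab; rewrite !inE.
have hU' : ~: (X :|: path_edges (q.1 :: s) :|: (Y :|: D))
          \subset U :\: c.
  rewrite cE; apply/subsetP => ab.
  rewrite !(in_setC, in_setD, in_setI, in_setU).
  by case: (_ \in X); case: (_ \in Y); case: (_ \in D); rewrite ?orbT.
have := subset_leq_card hU'; rewrite cardsD (setIidPr _); last first.
  by apply/subsetP => ab; rewrite inE => /andP[].
set U' := ~: _ => cU'.
have c_le : #|c| <= #|U| by apply/subset_leq_card/subsetP => ab; rewrite inE => /andP[].
case: r hr => [|r] hr; first by move: hr; rewrite !expn0; lia.
exists (j + r); first lia.
have t_gt0 : 0 < t by case: (t) hU2 => //; lia.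
have c_gt0 : 0 < #|c|.
  by case: (posnP #|c|) hU2 => // ->; rewrite muln0 leqNgt U_gt0.
apply: IH => //.
- by move=> a; rewrite inE Yd.
- move=> a b; rewrite inE => /orP[/Ye //|]; rewrite inE => hro.
  apply: (@rules_out_sound _ (rel_of X) e q.1 q.2) => //.
    by apply: leq_trans sz; rewrite -ls; apply: gdist_le_path.
- by apply: leq_trans hj; apply/subset_leq_card/setDS/subsetUl.
- rewrite -ltnS; apply: leq_trans hU; apply: leq_ltn_trans cU' _.
  by rewrite ltn_subrL c_gt0.
(* At least [#|U| / t] pairs are settled, so [t * #|U'| <= #|U| * t.-1]. *)
- rewrite -/U' -(ltn_pmul2l t_gt0) -expnS; apply: leq_ltn_trans hr.
  rewrite expnS !mulnA leq_mul2r; apply/orP; right.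
  apply: leq_trans (leq_mul (leqnn t) cU') _.
  by rewrite mulnBr -subn1 mulnBr muln1 [t * _]mulnC leq_sub2l.
Qed.

(** * Hubs from tree decompositions *)

(* A breadth-first parent function accounts for [m.-1] edges, that is, for all
   of them. *)
Lemma tree_parent m (t : rel 'I_m) : is_tree t ->
  exists (r : 'I_m) (par : 'I_m -> 'I_m) (depth : 'I_m -> nat),
    [/\ par r = r, forall x, x != r -> depth x = (depth (par x)).+1 &
        forall x y, t x y -> (x != r /\ par x = y) \/ (y != r /\ par y = x)].
Proof.
move=> [m0 [[t0 ts] [tc tE]]]; pose r := Ordinal m0.
pose par x := if x == r then r else
  odflt x [pick y | t y x && ((gdist t r y).+1 == gdist t r x)].
have parP x : x != r -> t (par x) x /\ gdist t r x = (gdist t r (par x)).+1.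
  move=> xr; rewrite /par (negPf xr); case: pickP => [y /andP[tyx /eqP <-] //|none].
  have d0 : 0 < gdist t r x.
    by rewrite lt0n; apply: contraNneq xr => /gdist_eq0 ->.
  have [] := @gdist_path_split _ t r x (gdist t r x).-1 (tc r x) (leq_pred _).
  move=> y [dy dyx]; have := none y; rewrite dy prednK // eqxx andbT.
  have dyx1 : gdist t y x <= 1 by rewrite dyx; case: (gdist t r x) d0 => // d _; rewrite subSn ?subnn.
  have /orP[/eqP yx|->//] := gdist_le1 (tc y x) dyx1.
  by move: d0 dy; rewrite yx; case: (gdist t r x) => //=; lia.
exists r, par, (gdist t r); split; first by rewrite /par eqxx.
  by move=> x /parP[].
(* The tree edges directed away from and towards the root: disjoint by depth and [m.-1] each, so
   together they exhaust the [(m.-1).*2] adjacent ordered pairs. *)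
pose P := [set (par x, x) | x in [set~ r]]; pose P' := [set (x, par x) | x in [set~ r]].
have cP : #|P| = m.-1 by rewrite card_imset ?cardsC1 ?card_ord // => x y [].
have cP' : #|P'| = m.-1 by rewrite card_imset ?cardsC1 ?card_ord // => x y [].
have dis : P :&: P' = set0.
  apply/setP => -[a b]; rewrite !inE; apply/negP => /andP[/imsetP[x xr [-> ->]] /imsetP[y yr [e1 e2]]].
  rewrite !inE in xr yr; have [_ d1] := parP _ xr; have [_ d2] := parP _ yr.
  by rewrite e1 in d1; rewrite -e2 d1 in d2; lia.
have PE : P :|: P' = [set p | t p.1 p.2].
  apply/eqP; rewrite eqEcard tE cardsU dis cards0 subn0 cP cP' addnn leqnn andbT.
  apply/subsetP => p; rewrite !inE => /orP[] /imsetP[x + ->]; rewrite !inE /= => /parP[tx _] //.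
  by rewrite ts.
move=> x y txy; have : (x, y) \in P :|: P' by rewrite PE inE.
rewrite inE => /orP[] /imsetP[z + [-> ->]]; rewrite !inE => zr; [right|left]; done.
Qed.

(** [D] is a union of components of the tree without [x]. The bags of a vertex outside [B x] are
    connected and avoid [x], and adjacent vertices share a bag, so a path avoiding [B x] cannot
    change sides. *)
Lemma decomposition_side n m (h : rel 'I_n) (t : rel 'I_m) B (bag : 'I_n -> 'I_m) x
    (D : pred 'I_m) :
  tree_decomposition h t B -> (forall v, v \in B (bag v)) ->
  (forall i j, t i j -> i != x -> j != x -> D i = D j) ->
  forall a p, path h a p -> (forall s, s \in a :: p -> s \notin B x) ->
  D (bag a) = D (bag (last a p)).
Proof.
move=> [_ [_ [hedge hconn]]] hbag hD.
have side v i j : v \notin B x -> v \in B i -> v \in B j -> D i = D j.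
  move=> vx vi vj; apply: closed_connect (hconn _ _ _ vi vj) => k l /= /and3P[tkl vk vl].
  by apply: hD => //; apply: contraNneq vx => <-.
move=> a p; elim: p a => //= b p IH a /andP[hab hp] hs.
have [i /andP[ai bi]] := hedge _ _ hab.
have ax : a \notin B x by apply: hs; rewrite mem_head.
have bx : b \notin B x by apply: hs; rewrite !inE eqxx orbT.
rewrite (side _ _ _ ax (hbag a) ai) (side _ _ _ bx bi (hbag b)).
by apply: IH => // s sp; apply: hs; rewrite inE sp orbT.
Qed.

Lemma fconnect_step (T : finType) (f : T -> T) x y : x != y ->
  fconnect f x y = fconnect f (f x) y.
Proof.
move=> xy; apply/idP/idP => [/connectP[[|z p] /= ep ly]|].
- by rewrite ly eqxx in xy.
- by case/andP: ep => /eqP -> ep; apply/connectP; exists p.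
- by apply: connect_trans; apply: fconnect1.
Qed.

Lemma fconnect_pred (T : finType) (f : T -> T) x y : fconnect f x y -> x != y ->
  exists c, [/\ f c = y, c != y & fconnect f x c].
Proof.
move=> xy nxy; have ex : exists k, iter k f x == y.
  by exists (findex f x y); rewrite iter_findex.
case: (ex_minnP ex) => -[|k] /eqP ky kmin; first by rewrite -ky eqxx in nxy.
exists (iter k f x); split=> //; last exact: fconnect_iter.
by apply/negP => /kmin; rewrite ltnn.
Qed.

(* Recursive centroid decomposition: the hubs of [v] are the centroid bags of
   the parts to which [v] successively belongs. *)
Lemma hub_labels n m (h : rel 'I_n) (t : rel 'I_m) B w :
  tree_decomposition h t B -> (forall i, #|B i| <= w) ->
  forall k (W : {set 'I_n}), #|W| < 2 ^ k ->
  exists S : 'I_n -> {set 'I_n}, (forall v, #|S v| <= k * w) /\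
    forall a p, a \in W -> last a p \in W -> path h a p ->
      exists s, [/\ s \in a :: p, s \in S a & s \in S (last a p)].
Proof.
move=> hdec hw; have [htree [hcov _]] := hdec.
have [bag hbag] := fin_all_exists hcov.
have [r [par [depth [parr hdepth hedge]]]] := tree_parent htree.
pose desc c y := fconnect par y c.
have descr y : desc r y.
  elim: {y}(depth y) {-2}y (leqnn (depth y)) => [|d IH] y.
    have [-> _|yr] := eqVneq y r; first exact: connect0.
    by rewrite hdepth.
  have [-> _|yr] := eqVneq y r; first exact: connect0.
  by rewrite hdepth // ltnS /desc fconnect_step // => /IH.
elim=> [|k IH] W.
  rewrite expn0 ltnS leqn0 cards_eq0 => /eqP ->.
  by exists (fun=> set0); split=> [v|a p]; rewrite ?cards0 ?inE.
move=> hW; have [W0|W0] := posnP #|W|.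
  move/eqP: W0; rewrite cards_eq0 => /eqP ->.
  by exists (fun=> set0); split=> [v|a p]; rewrite ?cards0 ?inE.
pose heavy x := #|W| < #|[set v in W | desc x (bag v)]|.*2.
have heavyr : heavy r.
  rewrite /heavy (_ : [set v in W | _] = W); first by lia.
  by apply/setP => v; rewrite inE descr andbT.
(* For a deepest heavy node [x], less than half of [W] lies outside its subtree and at most half
   below any one child. The index [x] of [part] stands for the outside. *)
case: (arg_maxnP depth heavyr) => x hx xmax.
pose child c := (c != r) && (par c == x).
pose part c := if c == x then [set v in W | ~~ desc x (bag v)]
  else [set v in W | child c && desc c (bag v)].
have part_small c : #|part c| < 2 ^ k.
  rewrite expnS in hW; rewrite /part; case: ifP => cx.
    have : #|[set v in W | desc x (bag v)]| + #|[set v in W | ~~ desc x (bag v)]| = #|W|.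
      rewrite -(cardsID [set v in W | desc x (bag v)] W); congr addn.
        by apply: eq_card => v; rewrite !inE; case: (v \in W).
      by apply: eq_card => v; rewrite !inE; case: (v \in W); rewrite ?andbT ?andbF.
    by rewrite /heavy in hx; lia.
  case chc: (child c); last first.
    rewrite (_ : [set v in W | _] = set0) ?cards0 ?expn_gt0 //.
    by apply/setP => v; rewrite !inE andbF.
  have nh : ~~ heavy c.
    apply/negP => /xmax; case/andP: chc => cr /eqP pc.
    by rewrite (hdepth _ cr) pc; apply/negP; rewrite -ltnNge.
  rewrite /heavy -leqNgt in nh; have := leq_ltn_trans nh hW.
  by rewrite -mul2n ltn_pmul2l.
have [S hS] := fin_all_exists (fun c => IH _ (part_small c)).
(* The default of [odflt] is reached only when [bag v = x], and then [v] is in [B x]. *)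
pose cl v := if ~~ desc x (bag v) then x
  else odflt x [pick c | [&& c != x, child c & desc c (bag v)]].
exists (fun v => B x :|: S (cl v) v); split=> [v|a p aW lW hp].
  rewrite cardsU mulSn; apply: leq_trans (leq_subr _ _) _.
  by apply: leq_add (hw x) _; case: (hS (cl v)).
case: (boolP (has (mem (B x)) (a :: p))) => [/hasP[s sp sx]|/hasPn hav].
  have {}sx : s \in B x by [].
  by exists s; rewrite !inE sx.
have hside D := @decomposition_side _ _ _ _ _ _ x D hdec hbag.
(* Only tree edges at [x] leave the subtree of [x] or of one of its children. *)
have side_x : desc x (bag a) = desc x (bag (last a p)).
  apply: (hside (desc x)) => // i j tij ix jx; rewrite /desc.
  by case: (hedge _ _ tij) => -[_ <-]; rewrite ?(fconnect_step par ix) ?(fconnect_step par jx).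
have side_c c : child c -> desc c (bag a) = desc c (bag (last a p)).
  case/andP=> cr /eqP pc; apply: (hside (desc c)) => // i j tij ix jx; rewrite /desc.
  by case: (hedge _ _ tij) => -[_ pij]; rewrite -pij; [|symmetry];
    apply: fconnect_step; apply/eqP => ic; move: ix jx; rewrite -pij ic pc eqxx.
have cl_eq : cl a = cl (last a p).
  rewrite /cl side_x; case: ifP => // _; congr odflt; apply: eq_pick => c /=.
  by case chc: (child c) => //=; rewrite side_c.
have in_part v : v \in W -> v \notin B x -> v \in part (cl v).
  move=> vW vx; have nx : bag v != x by apply: contraNneq vx => <-.
  rewrite /part /cl; case: (boolP (desc x (bag v))) => dv /=; last by rewrite eqxx inE vW.
  case: pickP => [c /and3P[cx chc dc]|none] /=; first by rewrite (negPf cx) inE vW chc.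
  have [c [pc cx dc]] := fconnect_pred dv nx.
  have := none c; rewrite cx /child pc eqxx andbT /desc dc andbT.
  by move/negbFE/eqP => cr; rewrite -pc cr parr eqxx in cx.
have [_ /(_ a p) []//] := hS (cl a).
- by apply: in_part => //; apply: hav; rewrite mem_head.
- by rewrite cl_eq; apply: in_part => //; apply: hav; rewrite mem_last.
- by move=> s [sp sa sl]; exists s; rewrite !inE sa -cl_eq sl !orbT.
Qed.

(** * Certificates from hubs *)

(* With [|i - j| <= 1] for the distances [i], [j] of [s] to [a], [b], the
   neighbour of [s] towards the closer endpoint sees a difference of at least 2. *)
Lemma certifies_hub (T : finType) (h : rel T) (Q : {set T * T}) a b s :
  symmetric h -> (forall u v, connect h u v) -> a != b -> ~~ h a b ->
  gdist h a s + gdist h s b = gdist h a b ->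
  (forall x, gdist h s x <= 1 -> (x, a) \in Q /\ (x, b) \in Q) ->
  certifies h Q a b.
Proof.
move=> hs hc nab hab ds hQ.
have d2 : 1 < gdist h a b.
  rewrite ltnNge; apply/negP => /(gdist_le1 (hc a b)).
  by rewrite (negPf nab) (negPf hab).
have dsa := gdist_sym hs a s.
have [sa0|sa0] := posnP (gdist h a s).
  have as_ := gdist_eq0 sa0; have [|_ abQ] := hQ a; first by rewrite as_ gdistxx.
  by exists (a, b); rewrite /rules_out /= !gdistxx d2.
have [sb0|sb0] := posnP (gdist h s b).
  have sb_ := gdist_eq0 sb0; have [|baQ _] := hQ b; first by rewrite sb_ gdistxx.
  exists (b, a); split=> //.
  by rewrite /rules_out /= !gdistxx (gdist_sym hs b a) d2 orbT.
case: (leqP (gdist h s b) (gdist h a s)) => le.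
  have [x [sx xb]] := gdist_path_split (hc s b) sb0.
  have [|xaQ _] := hQ x; first by rewrite sx.
  exists (x, a); split=> //.
  rewrite /rules_out /= gdistxx; have := gdist_triangle h a x b; rewrite (gdist_sym hs a x) xb.
  lia.
rewrite dsa in sa0; have [x [sx xa]] := gdist_path_split (hc s a) sa0.
have [|_ xbQ] := hQ x; first by rewrite sx.
exists (x, b); split=> //.
rewrite /rules_out /= gdistxx; have := gdist_triangle h a x b; rewrite (gdist_sym hs a x) xa.
lia.
Qed.

(** Each [v] is queried against the closed neighbourhoods of its hubs. Applied to a shortest path
    from [a] to [b], the path hypothesis yields a common hub on that path. *)
Lemma hub_certificate (T : finType) (h : rel T) D (S : T -> {set T}) w :
  symmetric h -> (forall u v, connect h u v) ->
  (forall v, #|[set x | h v x]| <= D) -> (forall v, #|S v| <= w) ->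
  (forall a p, path h a p ->
     exists s, [/\ s \in a :: p, s \in S a & s \in S (last a p)]) ->
  exists Q : {set T * T}, #|Q| <= #|T| * (w * D.+1) /\
    forall a b, a != b -> ~~ h a b -> certifies h Q a b.
Proof.
move=> hs hc hD hw hS.
pose F v := \bigcup_(s in S v) [set (x, v) | x in [set x | gdist h s x <= 1]].
exists (\bigcup_(v in [set: T]) F v); split.
  rewrite -cardsT; apply: card_bigcup_leq => v _.
  apply: leq_trans (_ : #|S v| * D.+1 <= _); last by rewrite leq_mul2r hw orbT.
  apply: card_bigcup_leq => s _; rewrite card_imset; last by move=> x y [].
  by have := card_ball 1 s hc hD; rewrite /= muln1 add1n.
move=> a b nab hab; have [p [hp lp sp]] := gdistP (hc a b).
have [s [s_p sa sb]] := hS _ _ hp; rewrite lp in sb.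
apply: (certifies_hub (s := s)) => //; first exact: gdist_mem_path s_p.
by move=> x sx; split; apply/bigcupP; [exists a|exists b]; rewrite ?inE //;
  apply/bigcupP; exists s => //; apply/imsetP; exists x; rewrite ?inE.
Qed.

(** * Numerical estimates for exponential decay *)

Lemma bernoulli_half s : 2 * s ^ s.+1 <= s.+1 ^ s.+1.
Proof.
have [->|s0] := posnP s; first by rewrite exp0n.
(* Bernoulli's inequality [1 + k / s <= (1 + 1 / s) ^ k] with denominators cleared. *)
have H k : s ^ k * (s + k) <= s.+1 ^ k * s.
  elim: k => [|k IH]; first by rewrite !expn0 addn0.
  rewrite !expnS; have : s.+1 * (s ^ k * (s + k)) <= s.+1 * (s.+1 ^ k * s) by rewrite leq_mul2l IH orbT.
  nia.
have := H s.+1; rewrite -(leq_pmul2r s0); nia.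
Qed.

(** Every [T] factors [(T - 1) / T] multiply to at most [1 / 2]. *)
Lemma geometric_decay u l T : 0 < T -> u < 2 ^ l -> u * T.-1 ^ (l * T) < T ^ (l * T).
Proof.
case: T => // s _ hu /=; have [s0|s0] := posnP s.
  rewrite s0 exp1n muln1; case: l hu => [|l] hu; last by rewrite exp0n // muln0.
  by rewrite expn0 muln1.
apply: leq_trans (_ : 2 ^ l * s ^ (l * s.+1) <= _); first by rewrite ltn_mul2r hu expn_gt0 s0.
rewrite [l * _]mulnC !expnM -expnMn.
by case: l {hu} => // l; rewrite leq_exp2r // bernoulli_half.
Qed.

(** * Centers with small clusters *)

Lemma cauchy_schwarz_sum (T : finType) (W : {set T}) (b : T -> nat) :
  (\sum_(v in W) b v) ^ 2 <= #|W| * \sum_(v in W) b v ^ 2.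
Proof.
rewrite -(leq_pmul2l (_ : 0 < 2)) // -mulnn big_distrlr /= big_distrr /=.
under eq_bigr do rewrite big_distrr /=.
apply: leq_trans (_ : \sum_(v in W) \sum_(w in W) (b v ^ 2 + b w ^ 2) <= _).
  by apply: leq_sum => v _; apply: leq_sum => w _; apply: nat_Cauchy.
under eq_bigr do rewrite big_split /= sum_nat_const.
by rewrite big_split /= sum_nat_const -big_distrr /= addnn mul2n.
Qed.

Definition cluster (T : finType) (d : T -> T -> nat) (W A : {set T}) (x : T) : {set T} :=
  [set v in W | [forall c in A, d x v < d c v]].

Lemma clusterU1 (T : finType) (d : T -> T -> nat) (W A : {set T}) x y :
  cluster d W (y |: A) x = [set v in cluster d W A x | d x v < d y v].
Proof.
apply/setP => v; rewrite !inE -andbA; congr (_ && _); apply/forall_inP/andP.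
  move=> H; split; last by apply: H; rewrite !inE eqxx.
  by apply/forall_inP => c cA; apply: H; rewrite !inE cA orbT.
by case=> /forall_inP H hy c; rewrite !inE => /orP[/eqP -> //|/H].
Qed.

Definition large_clusters (T : finType) (d : T -> T -> nat) (W : {set T}) M (A : {set T}) :=
  [set x | M < #|cluster d W A x|].

(** A potential that vanishes exactly when no cluster has more than [M] elements. *)
Definition excess (T : finType) (d : T -> T -> nat) (W : {set T}) M (A : {set T}) :=
  \sum_(x in large_clusters d W M A) #|cluster d W A x|.

(* A center drawn uniformly among the vertices with a large cluster removes in
   expectation a fraction [1 / (2 * t)] of the excess: if [v] belongs to the
   clusters of [b] such vertices, it leaves on average half of them with
   probability proportional to [b]. *)
Lemma good_center (T : finType) (d : T -> T -> nat) (W : {set T}) M t (A : {set T}) :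
  #|W| <= t * M -> large_clusters d W M A != set0 ->
  exists y, excess d W M A <= (2 * t) * (excess d W M A - excess d W M (y |: A)).
Proof.
set X := large_clusters _ _ _ _ => hW X0.
pose I x v : nat := v \in cluster d W A x.
have CE x : #|cluster d W A x| = \sum_(v in W) I x v.
  rewrite -sum1_card big_mkcond [RHS]big_mkcond /=; apply: eq_bigr => v _.
  by rewrite /I inE; case: (v \in W).
(* [g y] is a lower bound for the decrease of the excess when [y] becomes a center. *)
pose g y := \sum_(x in X) #|[set v in cluster d W A x | d y v <= d x v]|.
have decr y : excess d W M (y |: A) + g y <= excess d W M A.
  rewrite addnC /excess -/X -leq_subRL; last first.
    apply: leq_sum => x _; apply/subset_leq_card/subsetP => v; by rewrite inE => /andP[].
  rewrite leq_subRL; last first.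
    apply: leq_sum => x _; apply/subset_leq_card/subsetP => v; by rewrite inE => /andP[].
  rewrite addnC.
  apply: leq_trans (_ : \sum_(x in X) #|cluster d W (y |: A) x| + g y <= _).
    rewrite leq_add2r [leqLHS]big_mkcond [leqRHS]big_mkcond; apply: leq_sum => x _ /=.
    case: ifP => //; rewrite !inE => h; rewrite (leq_trans h) //.
    rewrite clusterU1; apply/subset_leq_card/subsetP => v; by rewrite inE => /andP[].
  rewrite -big_split; apply: leq_sum => x _ /=.
  rewrite clusterU1 -(cardsID [set v | d x v < d y v] (cluster d W A x)) leq_eqVlt.
  apply/orP; left; apply/eqP; congr addn; apply: eq_card => v; rewrite !inE //.
  by rewrite -leqNgt andbC.
have [/existsP[y hy]|] := boolP [exists y, excess d W M A <= 2 * t * g y].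
  by exists y; apply: leq_trans hy _; rewrite leq_mul2l leq_subRL ?decr ?orbT //;
    apply: leq_trans (decr y); apply: leq_addr.
rewrite negb_exists => /forallP hg; exfalso.
pose b v := \sum_(x in X) I x v.
have PE : excess d W M A = \sum_(v in W) b v.
  by rewrite exchange_big /=; apply: eq_bigr => x _; rewrite CE.
(* Of two large clusters containing [v], at least one center is no farther from [v] than the other,
   so the [b v ^ 2] ordered pairs are counted at most twice. *)
have sq : \sum_(v in W) b v ^ 2 <= 2 * \sum_(y in X) g y.
  pose J v y x : nat := I x v * I y v * (d y v <= d x v).
  have JS : \sum_(v in W) \sum_(y in X) \sum_(x in X) J v y x <= \sum_(y in X) g y.
    rewrite exchange_big; apply: leq_sum => y _; rewrite exchange_big; apply: leq_sum => x _ /=.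
    rewrite -sum1_card [leqLHS]big_mkcond [leqRHS]big_mkcond /=; apply: leq_sum => v _.
    rewrite /J /I !inE; case: (v \in W); case: (d y v <= d x v); rewrite ?muln0 //=.
    by case: [forall c in A, d x v < d c v]; case: [forall c in A, d y v < d c v].
  have bJ v : b v ^ 2 <= \sum_(y in X) \sum_(x in X) (J v y x + J v x y).
    rewrite -mulnn big_distrlr; apply: leq_sum => y _; apply: leq_sum => x _ /=.
    rewrite /J /I; case: (leqP (d y v) (d x v)); case: (v \in _) => //; case: (v \in _) => //.
    by move/ltnW => ->.
  have : \sum_(v in W) b v ^ 2 <= \sum_(v in W) \sum_(y in X) \sum_(x in X) (J v y x + J v x y).
    by apply: leq_sum => v _; apply: bJ.
  move/leq_trans; apply.
  under eq_bigr do under eq_bigr do rewrite big_split.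
  under eq_bigr do rewrite big_split.
  rewrite big_split /= mul2n -addnn; apply: leq_add => //.
  by apply: leq_trans JS; under eq_bigr do rewrite exchange_big.
(* With [P] the excess and [G] the sum of [g], this gives [P ^ 2 <= 2 * t * M * G]. If no [y]
   worked, summing over [X] and using [M * #|X| <= P] would give the reverse strict inequality for
   [M > 0]. *)
have h1 := leq_trans (cauchy_schwarz_sum W b) (leq_mul hW sq).
rewrite -PE in h1.
have h2 : M * #|X| <= excess d W M A.
  apply: leq_trans (_ : \sum_(x in X) M <= _); first by rewrite sum_nat_const mulnC.
  by apply: leq_sum => x; rewrite inE; apply: ltnW.
have h3 : \sum_(y in X) 2 * t * g y + #|X| <= #|X| * excess d W M A.
  apply: leq_trans (_ : \sum_(y in X) excess d W M A <= _); last by rewrite sum_nat_const.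
  rewrite -sum1_card -big_split /=; apply: leq_sum => y _.
  by have := hg y; rewrite -ltnNge addn1.
rewrite -big_distrr /= in h3.
have X1 : 0 < #|X| by rewrite card_gt0.
move: h1 h2 h3; move: (excess _ _ _ _) (#|X|) X1 (\sum_(y in X) g y) => P x x0 G h1 h2 h3.
have h4 : M * (2 * t * G + x) <= M * (x * P) by rewrite leq_mul2l h3 orbT.
have h5 : M * x * P <= P * P by rewrite leq_mul2r h2 orbT.
have P0 : 0 < P by case: (P) h3 => //; lia.
have [M0|M0] := posnP M; first by move: h1; rewrite M0 muln0 mul0n; nia.
have h6 : 0 < M * x by rewrite muln_gt0 M0.
move: h1; rewrite -mulnn; nia.
Qed.

Lemma exists_centers (T : finType) (d : T -> T -> nat) (W : {set T}) M t :
  0 < M -> #|W| <= t * M -> forall r (A : {set T}),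
  excess d W M A * (2 * t).-1 ^ r < (2 * t) ^ r ->
  exists A' : {set T}, [/\ A \subset A', #|A'| <= #|A| + r &
    forall x, #|cluster d W A' x| <= M].
Proof.
move=> M0 hW; elim=> [|r IH] A hr.
  exists A; split=> //; first by rewrite addn0.
  move=> x; rewrite leqNgt; apply/negP => hx.
  move: hr; rewrite !expn0 muln1 ltnS leqn0 /excess (bigD1 x) ?inE //= addn_eq0.
  by case/andP=> /eqP h _; rewrite h in hx.
have [X0|X0] := eqVneq (large_clusters d W M A) set0.
  exists A; split=> //; first exact: leq_addr.
  move=> x; rewrite leqNgt; apply/negP => hx.
  by have := in_set0 x; rewrite -X0 inE hx.
have P0 : 0 < excess d W M A.
  case/set0Pn: X0 => x xX; rewrite /excess (bigD1 x) //= ltn_addr //.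
  by rewrite inE in xX; apply: leq_ltn_trans xX.
have [y hy] := good_center hW X0.
have [|A' [sA cA hA]] := IH (y |: A).
  move: P0 hr hy; move: (excess _ _ _ A) (excess _ _ _ (y |: A)) => P P' P0 hr hy.
  have t0 : 0 < 2 * t.
    by rewrite lt0n; apply: contraTneq hr => ->; rewrite [X in _ < X]exp0n.
  rewrite -(ltn_pmul2l t0) -expnS; apply: leq_ltn_trans hr.
  rewrite expnS !mulnA leq_mul2r; apply/orP; right.
  move: t0 hy; move: (2 * t) => s s0 hy; rewrite -subn1 mulnBr muln1.
  (* Subtraction is truncated: if [P'] exceeded [P], then [hy] would force [P = 0]. *)
  rewrite mulnBr in hy; have [le|lt] := leqP P' P; last first.
    by rewrite -mulnBr (eqP (ltnW lt)) muln0 leqNgt P0 in hy.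
  by have : s * P' <= s * P; [rewrite leq_mul2l le orbT | lia].
exists A'; split=> //.
  by apply: subset_trans sA; apply: subsetUr.
apply: leq_trans cA _; rewrite cardsU1 addnS -addSn leq_add2r.
by case: (y \in A).
Qed.

(** * Certificates from clusters *)

(* If [c] is a center nearest to [u], where [v] is at least as far from the
   centers as [u], and [x] is the vertex at distance 2 from [c] towards [u], then
   either the queries [(x, u)] and [(x, v)] rule out [uv], or [v] is
   closer to [x] than to any center, and so is [u]. *)
Lemma certifies_or_cluster (T : finType) (h : rel T) (W A : {set T})
    (Q : {set T * T}) u v :
  symmetric h -> (forall u v, connect h u v) -> A != set0 ->
  u \in W -> v \in W -> u != v -> ~~ h u v ->
  (forall c x w, c \in A -> gdist h c x <= 2 -> w \in W -> (x, w) \in Q) ->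
  certifies h Q u v \/ exists c x, [/\ c \in A, gdist h c x <= 2,
    u \in cluster (gdist h) W A x & v \in cluster (gdist h) W A x].
Proof.
move=> hs hc A0.
suff H a b : a \in W -> b \in W -> a != b -> ~~ h a b ->
    (forall c x w, c \in A -> gdist h c x <= 2 -> w \in W -> (x, w) \in Q) ->
    (exists2 c, c \in A & forall c', c' \in A -> gdist h c a <= gdist h c' a /\
                                     gdist h c a <= gdist h c' b) ->
    certifies h Q a b \/ exists c x, [/\ c \in A, gdist h c x <= 2,
      a \in cluster (gdist h) W A x & b \in cluster (gdist h) W A x].
  move=> uW vW nuv huv hQ; have /set0Pn[c0 c0A] := A0.
  have [cu cuA cumin] := arg_minnP (fun c => gdist h c u) c0A.
  have [cv cvA cvmin] := arg_minnP (fun c => gdist h c v) c0A.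
  case: (leqP (gdist h cu u) (gdist h cv v)) => le.
    apply: H => //; exists cu => // c' c'A; split; first exact: cumin.
    by apply: leq_trans le (cvmin _ _).
  case: (H v u) => //; first by rewrite eq_sym.
  - by rewrite hs.
  - exists cv => // c' c'A; split; first exact: cvmin.
    by apply: leq_trans (ltnW le) (cumin _ _).
  - case=> q [qQ hq]; left; exists q; split=> //.
    by move: hq; rewrite /rules_out orbC.
  - by case=> c [x [? ? ? ?]]; right; exists c, x.
move=> aW bW nab hab hQ [c cA cmin].
have d2 : 1 < gdist h a b.
  rewrite ltnNge; apply/negP => /(gdist_le1 (hc a b)).
  by rewrite (negPf nab) (negPf hab).
case: (leqP (gdist h c a) 2) => [le2|gt2].
  left; exists (a, b); split; first exact: hQ cA le2 bW.
  by rewrite /rules_out /= !gdistxx d2.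
have [x [cx xa]] := gdist_path_split (hc c a) (ltnW gt2).
case: (leqP (gdist h x b) (gdist h x a + 1)) => [le|gt]; last first.
  left; exists (x, b); split; first by apply: hQ cA _ bW; rewrite cx.
  by rewrite /rules_out /= gdistxx addn0 gt.
(* [gdist h x b <= gdist h x a + 1 < gdist h c a], which is at most the distance from any center to
   [a] or [b]. *)
right; exists c, x; split; rewrite ?cx // !inE ?aW ?bW /=; apply/forall_inP => c' c'A.
  by have [] := cmin c' c'A; lia.
by have [] := cmin c' c'A; lia.
Qed.

Lemma cluster_certificate (T : finType) (h : rel T) D l t :
  symmetric h -> (forall u v, connect h u v) ->
  (forall v, #|[set x | h v x]| <= D) -> #|T| < 2 ^ l -> 0 < t ->
  forall k (W : {set T}), #|W| <= t ^ k ->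
  exists Q : {set T * T}, #|Q| <= t ^ k.+1 * (2 * (5 * l * ball_bound D 2)) ^ k /\
    forall a b, a \in W -> b \in W -> a != b -> ~~ h a b -> certifies h Q a b.
Proof.
move=> hs hc hD hl t0; elim=> [|k IH] W hW.
  exists set0; rewrite cards0; split=> // a b aW bW.
  by rewrite expn0 in hW; rewrite (card_le1_eqP hW a b aW bW) eqxx.
have [->|/set0Pn[w wW]] := eqVneq W set0.
  by exists set0; rewrite cards0; split=> // a b; rewrite inE.
have l0 : 0 < l.
  case: (l) hl => //; rewrite expn0 ltnS leqn0 => /eqP/card0_eq/(_ w).
  by rewrite inE.
have M0 : 0 < t ^ k by rewrite expn_gt0 t0.
(* Starting from [[set w]] keeps the centers nonempty. The initial excess is at most
   [#|T| ^ 2 < 2 ^ (2 * l)], which fixes the number of rounds. *)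
have [||A [sA cA hA]] := @exists_centers T (gdist h) W _ t M0 _ (2 * l * (2 * t)) [set w].
- by rewrite -expnS.
- apply: geometric_decay; first by rewrite muln_gt0.
  rewrite mul2n -addnn expnD; apply: leq_ltn_trans (_ : #|T| * #|T| < _); last by rewrite ltn_mul.
  rewrite /excess; apply: leq_trans (_ : \sum_(x in large_clusters (gdist h) W (t ^ k) [set w]) #|T| <= _).
    by apply: leq_sum => x _; apply: max_card.
  by rewrite sum_nat_const leq_mul2r max_card orbT.
(* The number of centers is at most [1 + 4 * l * t <= 5 * l * t]. *)
set K := 5 * l * ball_bound D 2.
have K0 : 0 < K by rewrite /K !muln_gt0 l0.
pose N := \bigcup_(c in A) [set x | gdist h c x <= 2].
have cN : #|N| <= K * t.
  have := card_bigcup_leq (A := A) (fun c _ => card_ball 2 c hc hD).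
  rewrite -/N => hN; apply: leq_trans hN _.
  rewrite /K mulnAC leq_mul2r; apply/orP; right; apply: leq_trans cA _.
  rewrite cards1; nia.
have [Qx hQx] := fin_all_exists (fun x => IH _ (hA x)).
exists (setX N W :|: \bigcup_(x in N) Qx x); split.
  (* The factor [2] in [2 * K] absorbs the queries of [setX N W] made at this level. *)
  apply: leq_trans (_ : K * t * t ^ k.+1 + K * t * (t ^ k.+1 * (2 * K) ^ k) <= _).
    rewrite cardsU; apply: leq_trans (leq_subr _ _) _; apply: leq_add.
      by rewrite cardsX leq_mul.
    have := card_bigcup_leq (A := N) (fun x _ => (hQx x).1).
    by move/leq_trans; apply; rewrite leq_mul2r cN orbT.
  have : 0 < (2 * K) ^ k by rewrite expn_gt0 muln_gt0 K0.
  rewrite !expnS; move: (t ^ k) ((2 * K) ^ k) => a b b0.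
  have -> : t * (t * a) * (2 * K * b) = K * t * (t * a) * b + K * t * (t * a) * b by lia.
  by rewrite [K * t * (t * a * b)]mulnA leq_add2r leq_pmulr.
move=> a b aW bW nab hab.
have A0 : A != set0 by apply/set0Pn; exists w; apply: (subsetP sA); rewrite inE.
have [||[c [x [cA' cx ax bx]]]] := @certifies_or_cluster T h W A
   (setX N W :|: \bigcup_(x in N) Qx x) a b hs hc A0 aW bW nab hab.
- move=> c x v cA' cx vW; rewrite !inE vW andbT; apply/orP; left.
  by apply/bigcupP; exists c; rewrite ?inE.
- by [].
have [q [qQ hq]] := (hQx x).2 _ _ ax bx nab hab.
exists q; split=> //; rewrite inE; apply/orP; right; apply/bigcupP; exists x => //.
by apply/bigcupP; exists c; rewrite ?inE.
Qed.

(** * Query counts *)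

(** The fuel is the number of ordered pairs; the diagonal is known to contain no edge. *)
Definition reconstruction_algorithm (n : nat) : qtree n :=
  greedy (n * n) set0 [set ab : 'I_n * 'I_n | ab.1 == ab.2].

Lemma degree_le_max n (h e : rel 'I_n) v : subrel h e ->
  #|[set w | h v w]| <= max_degree e.
Proof.
move=> he; apply: leq_trans (leq_bigmax (F := fun v => #|[set w | e v w]|) v).
by apply/subset_leq_card/subsetP => w; rewrite !inE => /he.
Qed.

Lemma max_degree_le n (e : rel 'I_n) : max_degree e <= n.
Proof. by apply/bigmax_leqP => v _; rewrite -[leqRHS]card_ord max_card. Qed.

Lemma max_degree_gt0 n (e : rel 'I_n) : 1 < n -> connected_graph e -> 0 < max_degree e.
Proof.
move=> n1 ec; pose u := Ordinal (ltnW n1); pose v := Ordinal n1.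
have /connectP[[//|w p] /= /andP[euw _] _] := ec u v.
apply: leq_trans (degree_le_max (h := e) u _); last by [].
by apply/card_gt0P; exists w; rewrite inE.
Qed.

Lemma reconstruction_algorithm_queries n (e : rel 'I_n) t l : simple_graph e ->
  0 < t -> n < 2 ^ l ->
  (forall h : rel 'I_n, simple_graph h -> connected_graph h -> subrel h e ->
     exists Q : {set 'I_n * 'I_n}, #|Q| <= t /\
       forall a b, a != b -> ~~ h a b -> certifies h Q a b) ->
  reconstructs e (reconstruction_algorithm n) (n * max_degree e + 2 * l * t).
Proof.
move=> he t0 hl hQ; apply: (greedy_reconstructs he hQ).
- by move=> a b; rewrite !inE.
- by move=> a b; rewrite /rel_of /= inE.
- by move=> a; rewrite inE eqxx.
- by move=> a b; rewrite inE => /eqP /= ->; rewrite he.1.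
- rewrite setD0; apply: leq_trans (_ : #|\bigcup_(a in [set: 'I_n])
     [set (a, b) | b in [set w | e a w]]| <= _).
    apply/subset_leq_card/subsetP => -[a b]; rewrite inE /= => eab.
    by apply/bigcupP; exists a; rewrite ?inE //; apply/imsetP; exists b; rewrite ?inE.
  rewrite -[X in _ <= X * _]card_ord -cardsT; apply: card_bigcup_leq => a _.
  by rewrite card_imset ?degree_le_max // => x y [].
- by apply: leq_trans (max_card _) _; rewrite card_prod card_ord.
- apply: geometric_decay => //; rewrite mul2n -addnn expnD.
  apply: leq_ltn_trans (_ : n * n < _); last by rewrite ltn_mul.
  by apply: leq_trans (max_card _) _; rewrite card_prod card_ord.
Qed.

Lemma decomposition_subrel n m (h e : rel 'I_n) (t : rel 'I_m) B :
  subrel h e -> tree_decomposition e t B -> tree_decomposition h t B.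
Proof. by move=> he [? [? [hedge ?]]]; do 3!split=> //; move=> x y /he /hedge. Qed.

(** The decomposition enters only the analysis: it remains one for every subgraph [h], and its bags
    have at most [tw.+1] vertices. *)
Lemma treewidth_queries n (e : rel 'I_n) l tw : simple_graph e ->
  0 < n -> n < 2 ^ l -> has_decomposition_of_width e tw ->
  reconstructs e (reconstruction_algorithm n)
    (n * max_degree e + 2 * l * (n * (l * tw.+1 * (max_degree e).+1))).
Proof.
move=> he n0 hl [m [t [B [hdec hB]]]].
have l0 : 0 < l by case: (l) hl => //; rewrite expn0 ltnS leqNgt n0.
apply: reconstruction_algorithm_queries => //; first by rewrite !muln_gt0 n0 l0.
move=> h [_ hs] hc hsub.
have hw i : #|B i| <= tw.+1.
  rewrite -hB /decomposition_width; apply: leq_trans (leqSpred _).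
  exact: leq_bigmax.
have [|S [hS hhub]] := hub_labels (decomposition_subrel hsub hdec) hw (W := [set: 'I_n]) (k := l).
  by rewrite cardsT card_ord.
rewrite -[X in X * (_ * _)]card_ord; apply: hub_certificate hS _ => //.
  by move=> v; apply: degree_le_max.
by move=> a p hp; apply: hhub; rewrite ?inE.
Qed.

Lemma general_queries n (e : rel 'I_n) l t k : simple_graph e ->
  0 < n -> n < 2 ^ l -> n <= t ^ k -> 0 < t ->
  reconstructs e (reconstruction_algorithm n)
    (n * max_degree e +
     2 * l * (t ^ k.+1 * (2 * (5 * l * ball_bound (max_degree e) 2)) ^ k)).
Proof.
move=> he n0 hl ht t0.
have l0 : 0 < l by case: (l) hl => //; rewrite expn0 ltnS leqNgt n0.
apply: reconstruction_algorithm_queries => //.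
  by rewrite !(muln_gt0, expn_gt0) t0 l0.
move=> h [_ hs] hc hsub.
have [|||Q [cQ hQ]] := @cluster_certificate _ h (max_degree e) l t hs hc _ _ t0 k [set: 'I_n].
- by move=> v; apply: degree_le_max.
- by rewrite card_ord.
- by rewrite cardsT card_ord.
by exists Q; split=> // a b; apply: hQ; rewrite inE.
Qed.

(** * Real estimates *)

Lemma INR_muln m n : INR (m * n) = (INR m * INR n)%R.
Proof. by rewrite -multE mult_INR. Qed.

Lemma INR_addn m n : INR (m + n) = (INR m + INR n)%R.
Proof. by rewrite -plusE plus_INR. Qed.

Lemma INR_expn m k : INR (m ^ k) = (INR m ^ k)%R.
Proof. by elim: k => [|k IH]; rewrite ?expn0 // expnS INR_muln IH. Qed.

Lemma INR_leq m n : (m <= n)%N -> (INR m <= INR n)%R.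
Proof. by move/leP; apply: le_INR. Qed.

Lemma exp_mul_INR x k : exp (INR k * x) = (exp x ^ k)%R.
Proof.
elim: k => [|k IH]; first by rewrite Rmult_0_l exp_0.
by rewrite S_INR Rmult_plus_distr_r Rmult_1_l exp_plus IH /= Rmult_comm.
Qed.

Lemma nat_ceil (x : R) : (0 < x)%R -> exists k : nat, (x <= INR k <= x + 1)%R.
Proof.
move=> x0; have [h1 h2] := archimed x.
exists (Z.to_nat (up x)); rewrite INR_IZR_INZ Z2Nat.id; first by lra.
by apply: le_IZR; lra.
Qed.

Lemma ln_le_of_le x y : (0 < x)%R -> (x <= y)%R -> (ln x <= ln y)%R.
Proof. by move=> x0 [/(ln_increasing _ _ x0) h | ->]; [apply: Rlt_le | apply: Rle_refl]. Qed.

Lemma log2_le_ln n : (2 < n)%N -> (1 <= ln (INR n))%R ->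
  (INR (trunc_log 2 n).+1 <= 3 * ln (INR n))%R.
Proof.
move=> n2 x1; have := INR_leq (trunc_logP (isT : 1 < 2) (ltnW (ltnW n2))).
rewrite INR_expn (S_INR (trunc_log 2 n)) => h.
have e2 : INR 2 = 2%R by rewrite /=; lra.
have hp : (0 < INR 2 ^ trunc_log 2 n)%R by apply: pow_lt; rewrite e2; lra.
have := ln_le_of_le hp h; rewrite ln_pow; last by rewrite e2; lra.
rewrite e2; have := ln_lt_2; have := pos_INR (trunc_log 2 n); nra.
Qed.

(** [exp (exp 1) <= exp 3 <= 27]; this makes [ln (ln n)] at least [1]. *)
Lemma ln_ge_exp1 n : (27 <= n)%N -> (exp 1 <= ln (INR n))%R.
Proof.
move=> /INR_leq; rewrite (_ : INR 27 = 27%R); last by rewrite INR_IZR_INZ.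
move=> h; rewrite -(ln_exp (exp 1)); apply: ln_le_of_le; first exact: exp_pos.
apply: Rle_trans h; have := exp_le_3; have := exp_pos 1 => p0 p3.
have : (exp (exp 1) <= exp 3)%R.
  by case: p3 => [/exp_increasing h | ->]; [apply: Rlt_le | apply: Rle_refl].
rewrite (_ : 3%R = (INR 3 * 1)%R); last by rewrite INR_IZR_INZ /=; lra.
rewrite exp_mul_INR /=; nra.
Qed.

Lemma treewidth_bound n D l tw : 0 < D -> (1 <= ln (INR n))%R ->
  (INR l <= 3 * ln (INR n))%R ->
  (INR (n * D + 2 * l * (n * (l * tw.+1 * D.+1))) <=
     100 * INR D * (INR D + INR tw * ln (INR n)) * INR n * ln (INR n) ^ 2)%R.
Proof.
move=> /INR_leq D1 x1 hl; have l0 := pos_INR l; have w0 := pos_INR tw; have n0 := pos_INR n.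
rewrite INR_addn !INR_muln (S_INR tw) (S_INR D) (_ : INR 2 = 2%R) //.
rewrite (_ : INR 1 = 1%R) // in D1.
move: (INR n) (INR tw) (INR D) (INR l) (ln (INR n)) D1 x1 hl l0 w0 n0 => m w d L x d1 x1 hl l0 w0 m0.
have wx : (w + 1 <= d + w * x)%R by nra.
set s := (d + w * x)%R in wx *.
have LL : (L * L <= 9 * (x * x))%R by nra.
have xx : (1 <= x * x)%R by nra.
have md : (0 <= m * d)%R by apply: Rmult_le_pos; lra.
have sx : (1 <= s * (x * x))%R by nra.
have h1 : (m * d <= m * d * (s * (x * x)))%R by nra.
have h2 : ((w + 1) * (L * L) <= s * (9 * (x * x)))%R by apply: Rmult_le_compat; nra.
have h3 : (m * d * ((w + 1) * (L * L)) <= m * d * (s * (9 * (x * x))))%R.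
  by apply: Rmult_le_compat_l.
have h4 : (m * ((w + 1) * (L * L)) * (d + 1) <= m * ((w + 1) * (L * L)) * (2 * d))%R.
  by apply: Rmult_le_compat_l; [apply: Rmult_le_pos; nra | lra].
nra.
Qed.

Lemma general_queries_le_exp (n D l t k : nat) (x y s : R) : 0 < k -> 0 < D ->
  INR n = exp x -> (exp 1 <= x)%R -> (y = ln x + ln (INR D))%R ->
  (0 < s)%R -> (s * s * x = y)%R -> (y <= 2 * x)%R -> (1 <= y)%R ->
  (INR l <= 3 * x)%R -> (/ s <= INR k <= / s + 1)%R ->
  (INR t <= 2 * exp (x / INR k))%R ->
  (INR (n * D + 2 * l * (t ^ k.+1 * (2 * (5 * l * ball_bound D 2)) ^ k)) <=
   exp ((1 + 100 * s) * x))%R.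
Proof.
move=> /INR_leq k1 /INR_leq d1 nx xe yE s0 sy yx y1 hl [k2 k3] ht.
rewrite (_ : INR 1 = 1%R) // in k1 d1.
have e2 : (2 <= exp 1)%R by have := exp_ineq1_le 1; lra.
have x2 : (2 <= x)%R by lra.
have l0 := pos_INR l; have t0 := pos_INR t.
(* Half of [Z] bounds [2 * 5 * l * ball_bound D 2], by [l <= 3 * x] and
   [1 + D + D ^ 2 <= 3 * D ^ 2]. The other factor [2] absorbs the [2 ^ k] from rounding [t] up. *)
pose Z := (180 * x * (INR D * INR D))%R.
have dd : (INR D <= INR D * INR D)%R by nra.
have Z1 : (180 * INR D <= Z)%R by rewrite /Z; nra.
have Zx : (180 * x <= Z)%R by rewrite /Z; nra.
have base : (INR (2 * (5 * l * ball_bound D 2)) <= Z / 2)%R.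
  have bE : INR (ball_bound D 2) = (1 + INR D * (1 + INR D * 1))%R.
    by rewrite [ball_bound _ _]/= !(INR_addn, INR_muln).
  rewrite !INR_muln bE (_ : INR 2 = 2%R) // (_ : INR 5 = 5%R); last by rewrite /=; lra.
  have h : (1 + INR D * (1 + INR D * 1) <= 3 * (INR D * INR D))%R by nra.
  rewrite /Z; have : (INR l * (1 + INR D * (1 + INR D * 1)) <= (3 * x) * (3 * (INR D * INR D)))%R.
    by apply: Rmult_le_compat => //; nra.
  nra.
have Zk : (exp (x / INR k) ^ k = exp x)%R.
  by rewrite -exp_mul_INR; congr exp; field; lra.
set r := exp (x / INR k) in ht Zk.
have r0 : (0 < r)%R by apply: exp_pos.
have r1 : (1 <= r)%R.
  rewrite -exp_0 /r; apply: Rlt_le; apply: exp_increasing; apply: Rdiv_lt_0_compat; lra.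
have bp := pos_INR (2 * (5 * l * ball_bound D 2)).
have h1 : (INR (t ^ k.+1) <= 2 * r * 2 ^ k * exp x)%R.
  rewrite INR_expn -Zk; apply: Rle_trans (pow_incr _ _ k.+1 (conj t0 ht)) _.
  by rewrite Rpow_mult_distr /=; apply: Req_le; ring.
have h2 : (INR ((2 * (5 * l * ball_bound D 2)) ^ k) <= (Z / 2) ^ k)%R.
  by rewrite INR_expn; apply: pow_incr.
have h3 : (2 ^ k * (Z / 2) ^ k = Z ^ k)%R.
  by rewrite -Rpow_mult_distr; congr pow; field.
have ex0 := exp_pos x.
have zk1 : (1 <= Z ^ k)%R by apply: pow_R1_Rle; lra.
have h4 : (INR (t ^ k.+1 * (2 * (5 * l * ball_bound D 2)) ^ k) <= 2 * r * exp x * Z ^ k)%R.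
  rewrite INR_muln -h3.
  apply: Rle_trans (Rmult_le_compat _ _ _ _ (pos_INR _) (pos_INR _) h1 h2) _.
  by apply: Req_le; ring.
have h5 : (INR (n * D + 2 * l * (t ^ k.+1 * (2 * (5 * l * ball_bound D 2)) ^ k)) <=
           exp x * r * (Z * Z ^ k))%R.
  rewrite INR_addn INR_muln (INR_muln (2 * l)) (INR_muln 2 l) nx (_ : INR 2 = 2%R); last by rewrite /=; lra.
  have q0 : (0 <= exp x * r * Z ^ k)%R by apply: Rmult_le_pos; nra.
  have a1 : (exp x * INR D <= exp x * r * Z ^ k * INR D)%R.
    apply: Rmult_le_compat_r; first lra.
    have : (1 * 1 <= r * Z ^ k)%R by apply: Rmult_le_compat; lra.
    nra.
  have a2 : (2 * INR l * INR (t ^ k.+1 * (2 * (5 * l * ball_bound D 2)) ^ k) <=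
             6 * x * (2 * r * exp x * Z ^ k))%R.
    by apply: Rmult_le_compat; [lra | apply: pos_INR | lra | exact: h4].
  have a3 : (exp x * r * Z ^ k * (INR D + 12 * x) <= exp x * r * Z ^ k * Z)%R.
    by apply: Rmult_le_compat_l => //; lra.
  lra.
apply: Rle_trans h5 _.
have Z0 : (0 < Z)%R by lra.
have lnZ : (ln Z <= 10 * y)%R.
  have ln180 : (ln 180 <= 8)%R.
    rewrite -(ln_exp 8); apply: ln_le_of_le; first lra.
    rewrite (_ : 8%R = (INR 8 * 1)%R); last by rewrite /=; lra.
    have h8 : (2 ^ 8 <= exp 1 ^ 8)%R by apply: pow_incr; lra.
    by rewrite exp_mul_INR; lra.
  have lnd : (0 <= ln (INR D))%R by rewrite -ln_1; apply: ln_le_of_le; lra.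
  have lnx : (0 <= ln x)%R by rewrite -ln_1; apply: ln_le_of_le; lra.
  have D2 : (0 < INR D * INR D)%R by nra.
  rewrite /Z ln_mult //; last lra.
  rewrite (ln_mult 180) ?(ln_mult (INR D)); lra.
have -> : (Z * Z ^ k = exp (INR k.+1 * ln Z))%R.
  by rewrite exp_mul_INR exp_ln.
rewrite /r -!exp_plus.
suff : (x + x / INR k + INR k.+1 * ln Z <= (1 + 100 * s) * x)%R.
  by case=> [/exp_increasing/Rlt_le // | ->]; apply: Rle_refl.
have b1 : (/ INR k <= s)%R.
  rewrite -[s]Rinv_inv; apply: Rinv_le_contravar => //; exact: Rinv_0_lt_compat.
have b2 : (x / INR k <= x * s)%R by apply: Rmult_le_compat_l; lra.
have ss : (s * s <= 2)%R by apply: (Rmult_le_reg_r x); lra.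
have s32 : (s <= 3 / 2)%R by nra.
(* As [y = s * s * x] and [s <= 3 / 2], this term is at most [40 * s * x]; [x / INR k] adds at most
   [s * x]. *)
have b3 : (INR k.+1 * ln Z <= (/ s + 2) * (10 * y))%R.
  rewrite S_INR; have := pos_INR k => k0.
  apply: Rle_trans (_ : ((INR k + 1) * (10 * y) <= _)%R); first by apply: Rmult_le_compat_l; lra.
  by apply: Rmult_le_compat_r; lra.
have b4 : ((/ s + 2) * (10 * y) = 10 * (s * x) + 20 * (s * (s * x)))%R.
  by rewrite -sy; field; lra.
have sx : (0 <= s * x)%R by nra.
have b5 : (s * (s * x) <= 3 / 2 * (s * x))%R by apply: Rmult_le_compat_r.
lra.
Qed.

(** Taking [k] about [1 / s] balances the exponents [ln n / k] and [k * y], both of order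
    [s * ln n]; [t] is [n ^ (1 / k)] rounded up. *)
Lemma general_bound n D l : (27 <= n)%N -> (0 < D <= n)%N ->
  (INR l <= 3 * ln (INR n))%R ->
  exists k t : nat, [/\ (n <= t ^ k)%N, (0 < t)%N &
  (INR (n * D + 2 * l * (t ^ k.+1 * (2 * (5 * l * ball_bound D 2)) ^ k)) <=
   Rpower (INR n) (1 + 100 * sqrt ((ln (ln (INR n)) + ln (INR D)) / ln (INR n))))%R].
Proof.
move=> n27 /andP[D0 Dn] hl; have xe := ln_ge_exp1 n27.
have d1 := INR_leq D0; have dn := INR_leq Dn; rewrite (_ : INR 1 = 1%R) // in d1.
set x := ln (INR n) in hl xe *.
have e2 : (2 <= exp 1)%R by have := exp_ineq1_le 1; lra.
have nx : INR n = exp x by rewrite exp_ln //; lra.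
have lnx : (1 <= ln x)%R by rewrite -(ln_exp 1); apply: ln_le_of_le => //; exact: exp_pos.
have lnxx : (ln x <= x)%R.
  have := exp_ineq1_le (ln x); rewrite exp_ln; lra.
have lnd : (0 <= ln (INR D))%R by rewrite -ln_1; apply: ln_le_of_le; lra.
have lndx : (ln (INR D) <= x)%R by apply: ln_le_of_le; lra.
set y := (ln x + ln (INR D))%R.
set s := sqrt (y / x).
have yx0 : (0 < y / x)%R by apply: Rdiv_lt_0_compat; rewrite /y; lra.
have s0 : (0 < s)%R by apply: sqrt_lt_R0.
have sy : (s * s * x = y)%R by rewrite sqrt_sqrt; [field; lra | lra].
have [k [k1 k2]] := nat_ceil (Rinv_0_lt_compat _ s0).
have k0 : (0 < k)%N.
  rewrite lt0n; apply/eqP => kz; rewrite kz /= in k1.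
  have := Rinv_0_lt_compat _ s0; lra.
have k0' : (0 < INR k)%R by apply: lt_0_INR; apply/ltP.
have [t [t1 t2]] := nat_ceil (exp_pos (x / INR k)).
have r1 : (1 <= exp (x / INR k))%R.
  by rewrite -exp_0; apply: Rlt_le; apply: exp_increasing; apply: Rdiv_lt_0_compat; lra.
exists k, t; split.
- apply/leP; apply: INR_le; rewrite nx INR_expn.
  have -> : (exp x = exp (x / INR k) ^ k)%R.
    by rewrite -exp_mul_INR; congr exp; field; lra.
  by apply: pow_incr; split=> //; apply: Rlt_le; exact: exp_pos.
- by rewrite lt0n; apply/eqP => tz; rewrite tz /= in t1; lra.
rewrite /Rpower -/x; apply: (@general_queries_le_exp n D l t k x y s) => //; try (rewrite /y; lra).
Qed.

(** * Both bounds for the same greedy algorithm *)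

Theorem theorem2 :
  exists (A : forall n : nat, qtree n) (C : R) (N : nat),
    (0 < C)%R /\
    forall (n : nat) (e : rel 'I_n), (N <= n)%N ->
      simple_graph e -> connected_graph e ->
      (exists k : nat,
         reconstructs e (A n) k /\
         (INR k <= Rpower (INR n)
            (1 + C * sqrt ((ln (ln (INR n)) + ln (INR (max_degree e))) / ln (INR n))))%R) /\
      (forall tw : nat, treewidth e tw ->
         exists k : nat,
           reconstructs e (A n) k /\
           (INR k <= C * INR (max_degree e)
                      * (INR (max_degree e) + INR tw * ln (INR n))
                      * INR n * (ln (INR n)) ^ 2)%R).
Proof.
exists reconstruction_algorithm, 100%R, 27; split; first lra.
move=> n e n27 he hc.
have n2 : 2 < n by apply: leq_trans n27.
have n0 : 0 < n by apply: leq_trans n27.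
have x1 : (1 <= ln (INR n))%R.
  by have := ln_ge_exp1 n27; have := exp_ineq1_le 1; lra.
have hl := log2_le_ln n2 x1.
have hlog : n < 2 ^ (trunc_log 2 n).+1 by apply: trunc_log_ltn.
have D0 := max_degree_gt0 (ltnW n2) hc.
split=> [|tw [htw _]].
  have [k [t [hk t0 hb]]] := general_bound n27 (introT andP (conj D0 (max_degree_le e))) hl.
  by exists (n * max_degree e +
     2 * (trunc_log 2 n).+1 * (t ^ k.+1 * (2 * (5 * (trunc_log 2 n).+1 * ball_bound (max_degree e) 2)) ^ k));
    split=> //; apply: general_queries.
exists (n * max_degree e + 2 * (trunc_log 2 n).+1 *
   (n * ((trunc_log 2 n).+1 * tw.+1 * (max_degree e).+1))).
by split; [apply: treewidth_queries | apply: treewidth_bound].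
Qed.
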